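(* Let $f(x)=\frac12\|F(x)\|^2$, and suppose that: (A1) the level set $\mathcal{D}=\{x\in\mathbb{R}^n : f(x)\le f(x_0)\}$ is bounded, i.e. there is a positive constant $\omega$ with $\|x\|\le\omega$ for all $x\in\mathcal{D}$; (A2) there exist constants $L_1$ and $L_2$ such that for all $x,y\in\mathcal{D}$, $\|J(x)-J(y)\|\le L_1\|x-y\|$ and $\|F(x)-F(y)\|\le L_2\|x-y\|$. Then the sequence of iterates $\{x_k\}$ generated by the ASDH algorithm is contained in $\mathcal{D}$ and $$\liminf_{k\to\infty}\|g_k\|=0,$$ where $g_k=\nabla f(x_k)$. Moreover, if $\eta_{\max}<1$, then $$\lim_{k\to\infty}\|g_k\|=0.$$
   Context: **Problem.** $F=(F_1,\dots,F_m)^T:\mathbb{R}^n\to\mathbb{R}^m$ with each $F_i:\mathbb{R}^n\to\mathbb{R}$ twice continuously differentiable; $f(x)=\frac12\|F(x)\|^2$; $J(x)\in\mathbb{R}^{m\times n}$ is the Jacobian of $F$; $g(x)=\nabla f(x)=J(x)^TF(x)$. Write $F_k=F(x_k)$, $J_k=J(x_k)$, $g_k=g(x_k)$. $\|\cdot\|$ is the Euclidean norm for vectors and the induced 2-norm for matrices, and $v^i$ is the $i$th component of a vector $v$. **ASDH algorithm (Algorithm with Structured Diagonal Hessian).** Parameters: $x_0\in\mathbb{R}^n$, $\gamma,\theta\in(0,1)$, $0\le\eta_{\min}\le\eta_{\max}\le 1$, $0<l\le 1\le u<+\infty$, $\rho>0$. Initialize $H_0=I$, $Q_0=1$, $P_0=f(x_0)$.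 For $k=0,1,2,\dots$: 1. Direction: $d_k=-H_k^{-1}g_k$. 2. Nonmonotone line search: $\alpha_k$ is the first number $\alpha$ in the list $1,\frac12,\frac14,\dots$ for which $f(x_k+\alpha d_k)\le P_k+\theta\alpha\, g_k^Td_k$. 3. $x_{k+1}=x_k+\alpha_kd_k$ and $s_k=\alpha_kd_k=x_{k+1}-x_k$. 4. Compute $\hat y_k=J_{k+1}^TJ_{k+1}s_k$ and $\overline y_k=(J_{k+1}-J_k)^TF_{k+1}$. Then redefine some components (safeguarding), for each $i=1,\dots,n$: - if $s_k^i>0$ and $\hat y_k^i\le 0$, replace $\hat y_k^i$ by $\gamma\max\{|(J_{k+1}^TJ_{k+1}s_k)^i|,\rho\}$; - if $s_k^i>0$ and $\overline y_k^i\le 0$, replace $\overline y_k^i$ by $\gamma\max\{|(J_{k+1}^TF_{k+1})^i|,|(J_k^TF_{k+1})^i|,\rho\}$; - if $s_k^i<0$ and $\hat y_k^i\ge 0$, replace $\hat y_k^i$ by $-\gamma\max\{(J_{k+1}^TJ_{k+1}s_k)^i,\rho\}$; - if $s_k^i<0$ and $\overline y_k^i\ge 0$, replace $\overline y_k^i$ by $-\gamma\max\{|(J_{k+1}^TF_{k+1})^i|,|(J_k^TF_{k+1})^i|,\rho\}$. 5. With $y_k=\hat y_k+\overline y_k$ (after safeguarding), let $H_{k+1}$ be the diagonal matrix with diagonal entries $h_{k+1}^i$, $i=1,\dots,n$, where $h_{k+1}^i=1$ if $s_k^i=0$, and, if $s_k^i\ne0$, $h_{k+1}^i$ equals $y_k^i/s_k^i$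 if $l\le y_k^i/s_k^i\le u$, equals $l$ if $y_k^i/s_k^i<l$, and equals $u$ if $y_k^i/s_k^i>u$. 6. Choose $\eta_k\in[\eta_{\min},\eta_{\max}]$ and set $Q_{k+1}=\eta_kQ_k+1$, $P_{k+1}=\dfrac{\eta_kQ_kP_k+f(x_{k+1})}{Q_{k+1}}$. The stopping test of the practical algorithm is disregarded, so that infinite sequences are generated. *)

(* Defs.v *)
From HB Require Import structures.
From mathcomp Require Import all_boot all_order all_algebra.
From mathcomp Require Import all_classical all_reals all_analysis.
Set Implicit Arguments.
Unset Strict Implicit.
Unset Printing Implicit Defensive.
Import Order.TTheory GRing.Theory Num.Theory.
Import numFieldNormedType.Exports.
Local Open Scope classical_set_scope.
Local Open Scope ring_scope.

Section Calculus.
Context {R : realType}.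

(* The library norm `|v| on matrices is the maximum norm.  It induces the same
   topology and the same notion of differentiability as the Euclidean norm,
   but the Euclidean norm itself has to be introduced separately. *)
Definition enorm n (v : 'cV[R]_n) : R := Num.sqrt (\sum_i v i 0 ^+ 2).

(* The unit ball, rather than the unit sphere, keeps this set nonempty when
   n = 0. *)
Definition opnorm m n (A : 'M[R]_(m, n)) : R :=
  sup [set enorm (A *m v) | v in [set v : 'cV[R]_n | enorm v <= 1]].

Definition partial n (j : 'I_n) (h : 'cV[R]_n -> R) : 'cV[R]_n -> R :=
  'D_(delta_mx j 0) h.

Definition class_C2 n (h : 'cV[R]_n -> R) : Prop :=
  [/\ forall x, differentiable h x,
      forall j x, differentiable (partial j h) x &
      forall j k, continuous (partial k (partial j h))].

Definition gradient n (h : 'cV[R]_n -> R) (x : 'cV[R]_n) : 'cV[R]_n :=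
  \col_j partial j h x.

(* The library jacobian 'J acts on row vectors on the right; this is its
   transpose, acting on column vectors on the left. *)
Definition jac m n (F : 'cV[R]_n -> 'cV[R]_m) (x : 'cV[R]_n) : 'M[R]_(m, n) :=
  \matrix_(i, j) partial j (fun z => F z i 0) x.

Definition lsq m n (F : 'cV[R]_n -> 'cV[R]_m) (x : 'cV[R]_n) : R :=
  2^-1 * enorm (F x) ^+ 2.

Definition level_set n (f : 'cV[R]_n -> R) (x0 : 'cV[R]_n) : set 'cV[R]_n :=
  [set x | f x <= f x0].

End Calculus.

Section ASDH.
Context {R : realType} {m n : nat}.
Variables (F : 'cV[R]_n -> 'cV[R]_m) (x0 : 'cV[R]_n).
Variables (gamma theta etamin etamax l u rho : R).

Let f := lsq F.
Let g := gradient f.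
Let J := jac F.

(* The component y of a curvature vector is replaced when its sign does not
   agree strictly with that of the component s of the step. *)
Definition safeguard (s y cpos cneg : R) : R :=
  if (0 < s) && (y <= 0) then gamma * cpos
  else if (s < 0) && (0 <= y) then - (gamma * cneg)
  else y.

(* xk and xk1 are consecutive iterates, and s = xk1 - xk.  No absolute value
   is taken in cneg here, since it is used only when the component of
   J^T J s is nonnegative. *)
Definition yhat (xk1 s : 'cV[R]_n) : 'cV[R]_n :=
  let w := (J xk1)^T *m J xk1 *m s in
  \col_i safeguard (s i 0) (w i 0)
           (Num.max `|w i 0| rho) (Num.max (w i 0) rho).

Definition ybar (xk xk1 s : 'cV[R]_n) : 'cV[R]_n :=
  let w := (J xk1 - J xk)^T *m F xk1 in
  let a := (J xk1)^T *m F xk1 in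
  let b := (J xk)^T *m F xk1 in
  \col_i (let c := Num.max (Num.max `|a i 0| `|b i 0|) rho in
          safeguard (s i 0) (w i 0) c c).

Definition hess_entry (s y : R) : R :=
  if s == 0 then 1
  else if y / s < l then l
  else if u < y / s then u
  else y / s.

Definition next_hess (xk xk1 s : 'cV[R]_n) : 'M[R]_n :=
  let y := yhat xk1 s + ybar xk xk1 s in
  diag_mx (\row_i hess_entry (s i 0) (y i 0)).

Definition sufficient_decrease (x d : 'cV[R]_n) (P a : R) : bool :=
  f (x + a *: d) <= P + theta * a * ((g x)^T *m d) 0 0.

(* The sequences form an infinite run of the algorithm, with the iterates x,
   directions d, step lengths alpha and steps s. *)
Record ASDH_run (x d : nat -> 'cV[R]_n) (alpha : nat -> R)
    (s : nat -> 'cV[R]_n) (H : nat -> 'M[R]_n) (eta Q P : nat -> R) : Prop := {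
  run_x0 : x 0%N = x0;
  run_H0 : H 0%N = 1%:M;
  run_Q0 : Q 0%N = 1;
  run_P0 : P 0%N = f x0;
  run_dir : forall k, d k = - (invmx (H k) *m g (x k));
  run_step : forall k, exists j : nat,
    [/\ alpha k = 2^-1 ^+ j,
        sufficient_decrease (x k) (d k) (P k) (2^-1 ^+ j) &
        forall i : nat, (i < j)%N ->
          ~~ sufficient_decrease (x k) (d k) (P k) (2^-1 ^+ i)];
  run_s : forall k, s k = alpha k *: d k;
  run_x : forall k, x k.+1 = x k + s k;
  run_H : forall k, H k.+1 = next_hess (x k) (x k.+1) (s k);
  run_eta : forall k, etamin <= eta k <= etamax;
  run_Q : forall k, Q k.+1 = eta k * Q k + 1;
  run_P : forall k,
    P k.+1 = (eta k * Q k * P k + f (x k.+1)) / Q k.+1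
}.

End ASDH.

(* Main.v *)
Require Import Defs.
From HB Require Import structures.
From mathcomp Require Import all_boot all_order all_algebra.
From mathcomp Require Import all_classical all_reals all_analysis.
From mathcomp Require Import ring lra.
Import Order.TTheory GRing.Theory Num.Theory.
Import numFieldNormedType.Exports.
Local Open Scope classical_set_scope.
Local Open Scope ring_scope.

(* The diagonal entries of H_k lie in [l, u], so d_k is a descent direction of
   size comparable to g_k.  The level set is compact and g is continuous, hence
   g(y) - g(x) is small uniformly in x in the level set, for y close to x; here
   y may leave the level set, as rejected trial points can.  By the mean value
   theorem applied to the last rejected step, whenever |g_k| >= eps the accepted
   step gives f(x_{k+1}) <= P_k - c with c depending only on eps, and hence
   P_{k+1} <= P_k - c / Q_{k+1}.  As P_k >= 0 and Q_{k+1} <= k + 2, the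
   divergence of the harmonic series prevents this from holding for all large k;
   if eta_max < 1 then Q_k is bounded and it can hold only finitely often. *)

(** * Compactness and uniform continuity for column vectors *)

Lemma coord_le_mx_norm (R : realType) (m n : nat) (A : 'M[R]_(m, n)) i j :
  `|A i j| <= `|A|.
Proof.
rewrite [leRHS]/Num.norm /= mx_normrE.
exact: (le_bigmax _ (fun ij => `|A ij.1 ij.2|) (i, j)).
Qed.

Lemma mx_norm_le_coord (R : realType) (m n : nat) (A : 'M[R]_(m, n)) (c : R) :
  0 <= c -> (forall i j, `|A i j| <= c) -> `|A| <= c.
Proof.
move=> c0 Ac; rewrite [leLHS]/Num.norm /= mx_normrE.
by apply/bigmax_leP; split => //= -[i j] _.
Qed.

Lemma trmx_continuous (R : realType) (m n : nat) :
  continuous (@trmx R m n).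
Proof.
move=> A U /nbhs_ballP[e e0 eU]; apply/nbhs_ballP; exists e => // B [_ AB].
by apply: eU; split => // i j; rewrite !mxE.
Qed.

(** Transposition is continuous and does not increase the maximum norm, so compactness carries over
    from row vectors. *)
Lemma cV_bounded_closed_compact (R : realType) (n : nat) (A : set 'cV[R]_n) :
  bounded_set A -> closed A -> compact A.
Proof.
move=> [M [Mreal bdA]] clA.
have norm_tr m' n' (v : 'M[R]_(m', n')) : `|v^T| <= `|v|.
  by apply: mx_norm_le_coord => // i j; rewrite mxE coord_le_mx_norm.
have -> : A = trmx @` (trmx @^-1` A : set 'rV[R]_n).
  apply/seteqP; split => [v Av|_ [v /= Av <-]//].
  by exists v^T; rewrite /= trmxK.
apply: continuous_compact.
  apply: continuous_subspaceT; exact: trmx_continuous.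
apply: bounded_closed_compact.
  exists M; split => // N MN v /= Av.
  by rewrite -[v]trmxK (le_trans (norm_tr _ _ _))// bdA.
apply: closed_comp => // v _; exact: trmx_continuous.
Qed.

(** Only [x] is confined to [K], which gives more than uniform continuity on [K]. Half of a radius
    of continuity at a point of [K] serves all nearby centres, and compactness makes the choice
    uniform. *)
Lemma compact_continuity_modulus (R : realType) (V W : normedModType R)
    (g : V -> W) (K : set V) (e : R) :
  compact K -> continuous g -> 0 < e ->
  exists2 delta : R, 0 < delta &
    forall x y, K x -> `|y - x| < delta -> `|g y - g x| < e.
Proof.
move=> /compact_near_coveringP cK cg e0.
pose Pr (dl : R) x := forall y, `|y - x| < dl -> `|g y - g x| < e.
have /cK : forall x, K x -> \forall x' \near x & dl \near 0^'+, Pr dl x'.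
  move=> x Kx.
  have /cvgrPdist_lt/(_ (e / 2))/(_ ltac:(by rewrite divr_gt0)) := cg x.
  move=> /nbhs_ballP[r /= r0 ballr].
  have gr y : `|y - x| < r -> `|g y - g x| < e / 2.
    by move=> yx; rewrite distrC; apply: ballr; rewrite -ball_normE /= distrC.
  exists (ball x (r / 2), [set dl | dl < r / 2]) => /=.
    split; first by apply: nbhsx_ballx; rewrite divr_gt0.
    by apply: nbhs_right_lt; rewrite divr_gt0.
  move=> [x' dl] /= []; rewrite -ball_normE /= distrC => x'x dlr y yx'.
  have gx' : `|g x' - g x| < e / 2 by apply: gr; lra.
  have gy : `|g y - g x| < e / 2.
    by apply: gr; have := ler_distD x' y x; lra.
  by have := ler_distD (g x) (g y) (g x'); rewrite (distrC (g x)); lra.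
move=> near_delta; near (0 : R)^'+ => dl.
have dlP : K `<=` Pr dl by near: dl.
exists dl => // x y /dlP; exact.
Unshelve. all: by end_near. Qed.

(** * Comparison of the Euclidean and maximum norms *)

Section EuclideanNorm.
Context {R : realType} {n : nat}.
Implicit Types v w : 'cV[R]_n.

Lemma enorm_ge0 v : 0 <= enorm v.
Proof. exact: sqrtr_ge0. Qed.

Lemma sqr_enorm v : enorm v ^+ 2 = \sum_i v i 0 ^+ 2.
Proof. by rewrite sqr_sqrtr // sumr_ge0 // => i _; rewrite sqr_ge0. Qed.

Lemma normr_le_enorm v : `|v| <= enorm v.
Proof.
apply: mx_norm_le_coord => [|i k]; rewrite ?ord1; first exact: enorm_ge0.
rewrite -sqrtr_sqr ler_sqrt ?sumr_ge0// => [|j _]; last exact: sqr_ge0.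
by rewrite (bigD1 i)//= lerDl sumr_ge0// => j _; exact: sqr_ge0.
Qed.

Lemma dot_le_normr v w : (v^T *m w) 0 0 <= n%:R * (`|v| * `|w|).
Proof.
rewrite mxE (le_trans (ler_norm _))// (le_trans (ler_norm_sum _ _ _))//.
apply: (@le_trans _ _ (\sum_(i < n) `|v| * `|w|)); last first.
  by rewrite sumr_const card_ord mulr_natl.
by apply: ler_sum => i _; rewrite mxE normrM ler_pM// coord_le_mx_norm.
Qed.

Lemma enorm_le_normr v : enorm v <= n%:R * `|v|.
Proof.
rewrite -(ler_pXn2r (_ : 0 < 2)%N) ?nnegrE ?enorm_ge0 ?mulr_ge0//.
have -> : enorm v ^+ 2 = (v^T *m v) 0 0.
  by rewrite sqr_enorm mxE; apply: eq_bigr => i _; rewrite mxE expr2.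
apply: le_trans (dot_le_normr _ _) _.
rewrite exprMn -expr2 ler_wpM2r ?sqr_ge0// expr2.
(* What remains is n <= n * n, where n = 0 needs its own case. *)
by case: n => [|k]; rewrite ?mul0r// ler_peMr// ler1n.
Qed.

End EuclideanNorm.

(** * Continuity, gradients and the mean value theorem *)

Lemma continuous_mx (R : realType) (T : topologicalType) (m n : nat)
    (M : T -> 'M[R]_(m, n)) :
  (forall i j, continuous (fun x => M x i j)) -> continuous M.
Proof.
move=> cM x; apply/cvgrPdist_le => e e0.
near=> y; apply: mx_norm_le_coord => [|i j]; first exact: ltW.
rewrite !mxE; move: i j; near: y.
apply: filter_forall => i; apply: filter_forall => j.
exact: (cvgrPdist_le _ _).1 (cM i j x) e e0.
Unshelve. all: by end_near. Qed.

Lemma derive_gradient (R : realType) (n : nat) (h : 'cV[R]_n -> R)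
    (x v : 'cV[R]_n) :
  differentiable h x -> 'D_v h x = ((gradient h x)^T *m v) 0 0.
Proof.
move=> dh; rewrite mxE deriveE//.
have {1}-> : v = \sum_j v j 0 *: delta_mx j 0.
  by rewrite {1}[v]matrix_sum_delta; apply: eq_bigr => j _; rewrite big_ord1.
rewrite linear_sum; apply: eq_bigr => j _.
by rewrite linearZ/= !mxE /partial deriveE// mulrC.
Qed.

(** The one-variable mean value theorem is applied to [h] along the segment from [x] to [x + v]. *)
Lemma gradient_mean_value (R : realType) (n : nat) (h : 'cV[R]_n -> R)
    (x v : 'cV[R]_n) :
  (forall z, differentiable h z) ->
  exists2 t : R, 0 <= t <= 1 &
    h (x + v) - h x = ((gradient h (x + t *: v))^T *m v) 0 0.
Proof.
move=> dh; pose line (t : R) := x + t *: v.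
have dline (t : R) : is_diff t line ( *:%R^~ v).
  by apply: is_diff_eq; rewrite add0r.
have dphi (t : R) :
    is_derive t (1 : R) (h \o line) (((gradient h (line t))^T *m v) 0 0).
  have dhl : differentiable (h \o line) t by apply: differentiable_comp.
  apply: DeriveDef; first exact: diff_derivable.
  by rewrite deriveE// diff_comp//= diff_val scale1r -deriveE// derive_gradient.
have [t t01 ht] := MVT_segment (@ler01 R) (fun t _ => dphi t)
  (derivable_within_continuous (fun t _ => @ex_derive _ _ _ _ _ _ _ (dphi t))).
exists t; first by move: t01; rewrite in_itv.
by move: ht; rewrite /= /line scale1r scale0r addr0 subr0 mulr1.
Qed.

(** * Regularity of the least-squares objective *)

Section LeastSquares.
Context {R : realType} {m n : nat}.
Variable F : 'cV[R]_n -> 'cV[R]_m.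

Lemma lsqE : lsq F = 2^-1 *: \sum_(i < m) (fun z => F z i 0) ^+ 2.
Proof.
apply/funext => z; rewrite /lsq sqr_enorm.
by rewrite [RHS]/GRing.scale/= fct_sumE.
Qed.

Lemma lsq_ge0 z : 0 <= lsq F z.
Proof. by rewrite mulr_ge0 ?invr_ge0// sqr_ge0. Qed.

Hypothesis F_C2 : forall i, class_C2 (fun z => F z i 0).

Lemma differentiable_lsq x : differentiable (lsq F) x.
Proof.
rewrite lsqE; apply: differentiableZ; apply: differentiable_sum => i.
by apply: differentiableX; have [+ _ _] := F_C2 i; exact.
Qed.

(** This is g = J^T F by components. It builds the gradient from differentiable functions, whence
    its continuity. *)
Lemma partial_lsqE j :
  partial j (lsq F) =
    \sum_(i < m) (fun z => F z i 0) * partial j (fun z => F z i 0).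
Proof.
apply/funext => x; rewrite fct_sumE /partial lsqE.
have dF i : derivable (fun z => F z i 0) x (delta_mx j 0).
  by apply: diff_derivable; have [+ _ _] := F_C2 i; exact.
rewrite deriveZ; last by apply: derivable_sum => i; apply: derivableX.
rewrite derive_sum => [|i]; last exact: derivableX.
rewrite scaler_sumr; apply: eq_bigr => i _.
by rewrite deriveX// expr1 scalerA mulrA mulVf// mul1r.
Qed.

Lemma continuous_lsq : continuous (lsq F).
Proof. by move=> x; exact/differentiable_continuous/differentiable_lsq. Qed.

Lemma continuous_gradient_lsq : continuous (gradient (lsq F)).
Proof.
have cpart j : continuous (partial j (lsq F)).
  rewrite partial_lsqE => x.
  apply: (@big_ind _ (fun h : 'cV[R]_n -> R => {for x, continuous h})).
  - exact: cst_continuous.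
  - by move=> h1 h2 c1 c2; exact: continuousD.
  - move=> i _; have [dF dpF _] := F_C2 i.
    by apply: continuousM; apply: differentiable_continuous.
apply: continuous_mx => j k.
by under eq_fun do rewrite mxE; exact: cpart.
Qed.

End LeastSquares.

(** * Search directions and the line search *)

(** Componentwise d_i = - g_i / r_i with r_i in [l, u]. The slope is thus controlled by the squared
    Euclidean norm of [g], which dominates the squared maximum norm. *)
Lemma diag_direction (R : realType) (n : nat) (l u : R) (r : 'rV[R]_n)
    (g : 'cV[R]_n) (d := - (invmx (diag_mx r) *m g)) :
  0 < l -> (forall i, l <= r 0 i <= u) ->
  `|d| <= `|g| / l /\ (g^T *m d) 0 0 <= - (`|g| ^+ 2 / u).
Proof.
move=> l0 rlu.
have r0 i : 0 < r 0 i by have /andP[/(lt_le_trans l0)] := rlu i.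
have unit_r : diag_mx r \in unitmx.
  rewrite unitmxE det_diag unitfE; apply/prodf_neq0 => i _.
  by rewrite gt_eqF.
have rd : diag_mx r *m d = - g by rewrite mulmxN mulKVmx.
clearbody d.
have dE i : d i 0 = - (g i 0 / r 0 i).
  have /matrixP/(_ i 0) := rd; rewrite mul_diag_mx !mxE => rdi.
  by rewrite -mulNr -rdi mulrC mulKf// gt_eqF.
split.
  apply: mx_norm_le_coord => [|i j]; first by rewrite divr_ge0// ltW.
  rewrite ord1 dE normrN normrM normfV (gtr0_norm (r0 i)).
  apply: ler_pM; rewrite ?coord_le_mx_norm ?invr_ge0 ?(ltW (r0 i))//.
  by rewrite lef_pV2 ?posrE//; have /andP[] := rlu i.
(* Without indices [rlu] gives no sign for [u], but both sides are then 0. *)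
case: n => [|n] in r g d rd rlu r0 unit_r dE *.
  rewrite mxE big_ord0 (_ : g = 0) ?normr0 ?expr0n ?mul0r ?oppr0//.
  by apply/matrixP => -[].
have u0 : 0 < u by have /andP[_] := rlu ord0; exact: lt_le_trans.
apply: (@le_trans _ _ (- (enorm g ^+ 2 / u))); last first.
  rewrite lerN2 ler_pM2r ?invr_gt0// lerXn2r ?nnegrE ?enorm_ge0//.
  exact: normr_le_enorm.
rewrite sqr_enorm mxE mulr_suml -sumrN; apply: ler_sum => i _.
rewrite dE mxE mulrN lerN2 mulrA -expr2 ler_wpM2l ?sqr_ge0//.
by rewrite lef_pV2 ?posrE//; have /andP[] := rlu i.
Qed.

Lemma hess_entry_itv (R : realType) (l u s y : R) :
  0 < l <= 1 -> 1 <= u -> l <= hess_entry l u s y <= u.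
Proof.
move=> /andP[l0 l1] u1; rewrite /hess_entry.
(* The default entry 1 is admissible because l <= 1 <= u. *)
case: eqP => _; first by rewrite l1.
case: (ltP (y / s) l) => [_|ly]; first by rewrite lexx (le_trans l1).
by case: (ltP u (y / s)) => [_|yu]; rewrite ?ly// lexx (le_trans l1).
Qed.

(** An accepted full step gains enough by the slope bound alone. Otherwise the last rejected step,
    twice the accepted one, meets a point where the gradient has changed by at least [e], so its
    length is bounded below. *)
Lemma backtracking_decrease (R : realType) (n : nat) (h : 'cV[R]_n -> R)
    (K : set 'cV[R]_n) (theta l u eps : R) :
  (forall z, differentiable h z) -> continuous (gradient h) -> compact K ->
  0 < theta < 1 -> 0 < l -> 0 < u -> 0 < eps ->
  exists2 c, 0 < c &
    forall x d P j (gd := ((gradient h x)^T *m d) 0 0),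
    K x -> h x <= P -> eps <= enorm (gradient h x) ->
    `|d| <= `|gradient h x| / l -> gd <= - (`|gradient h x| ^+ 2 / u) ->
    h (x + 2^-1 ^+ j *: d) <= P + theta * 2^-1 ^+ j * gd ->
    (forall i, (i < j)%N ->
      ~~ (h (x + 2^-1 ^+ i *: d) <= P + theta * 2^-1 ^+ i * gd)) ->
    h (x + 2^-1 ^+ j *: d) <= P - c.
Proof.
move=> dh cg cK /andP[th0 th1] l0 u0 eps0.
(* The factor [n.+1] avoids division by zero when n = 0; [ep] will bound the maximum norm of the
   gradient from below. *)
have n1 : 0 < n.+1%:R :> R by [].
pose ep := eps / n.+1%:R; have ep0 : 0 < ep by rewrite divr_gt0.
(* Obtained by solving (1 - theta) |g|^2 / u <= (n + 1) e |g| / l for [e], with |g| replaced by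
   [ep]. *)
pose e := (1 - theta) * l * ep / (u * n.+1%:R).
have e0 : 0 < e by rewrite divr_gt0 ?mulr_gt0// subr_gt0.
have [dl dl0 unif_g] := compact_continuity_modulus _ _ _ _ _ _ cK cg e0.
(* The first bound serves an accepted full step, the second a step accepted after a rejection. *)
exists (Num.min (theta * ep ^+ 2 / u) (theta * l * dl * ep / (2 * u))).
  by rewrite lt_min !divr_gt0 ?mulr_gt0 ?exprn_gt0.
move=> x d P j; set g := gradient h x => gd Kx hxP epsg dg gdg acc rej.
have epg : ep <= `|g|.
  rewrite ler_pdivrMr// mulrC (le_trans epsg)// (le_trans (enorm_le_normr _))//.
  by rewrite ler_wpM2r// ler_nat.
apply: (le_trans acc); rewrite lerD2l lerNr ge_min.
case: j rej {acc} => [_|j rej]; apply/orP; [left|right].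
  rewrite expr0 mulr1 -mulrN -mulrA ler_pM2l//.
  rewrite lerNr (le_trans gdg)// lerN2 ler_pM2r ?invr_gt0//.
  by rewrite lerXn2r ?nnegrE ?(ltW ep0).
(* The accepted exponent is now j + 1, so [b] is the last rejected step length. *)
pose b : R := 2^-1 ^+ j; have b0 : 0 < b by rewrite exprn_gt0 ?invr_gt0.
have {rej} := rej j (leqnn _); rewrite -ltNge -/b => rejb.
have [t /andP[t0 t1] hmv] := gradient_mean_value _ _ _ x (b *: d) dh.
set xi := x + t *: (b *: d) in hmv.
(* Since h x <= P, rejection relative to [P] also holds relative to [h x]; the mean value identity
   is then divided by [b]. *)
have gd_xi : theta * gd < ((gradient h xi)^T *m d) 0 0.
  rewrite -(ltr_pM2l b0) mulrCA mulrA.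
  move: hmv; rewrite -scalemxAr mxE => hmv.
  by rewrite -/gd; lra.
have g_neq0 : 0 < `|g| by exact: lt_le_trans epg.
(* Subtracting [gd] in [gd_xi] leaves a gap of at least (1 - theta) |g|^2 / u between the slopes at
   [xi] and [x]. *)
have far : e <= `|gradient h xi - g|.
  have diff_gd : (1 - theta) * (`|g| ^+ 2 / u) <=
      ((gradient h xi - g)^T *m d) 0 0.
    have -> : ((gradient h xi - g)^T *m d) 0 0 =
        ((gradient h xi)^T *m d) 0 0 - gd.
      by rewrite linearB/= mulmxBl mxE [X in _ + X = _]mxE.
    have := ler_wpM2l (_ : 0 <= 1 - theta) gdg.
    rewrite subr_ge0 => /(_ (ltW th1)).
    lra.
  have := le_trans diff_gd (dot_le_normr _ _).
  set dist := `|_ - _|.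
  have dist0 : 0 <= dist by exact: normr_ge0.
  move=> dist_ge.
  have {}dist_ge :
      (1 - theta) * (`|g| ^+ 2 / u) <= n.+1%:R * (dist * (`|g| / l)).
    apply: (le_trans dist_ge).
    apply: ler_pM => //; rewrite ?mulr_ge0 ?ler_nat//.
    by rewrite ler_wpM2l.
  rewrite /e ler_pdivrMr ?mulr_gt0//.
  apply: (@le_trans _ _ ((1 - theta) * l * `|g|)).
    by rewrite ler_pM2l// mulr_gt0// subr_gt0.
  rewrite -(ler_pM2r (_ : 0 < `|g| / (l * u))); last first.
    by rewrite divr_gt0 ?mulr_gt0.
  suff [-> ->] :
      (1 - theta) * l * `|g| * (`|g| / (l * u)) =
        (1 - theta) * (`|g| ^+ 2 / u) /\
      dist * (u * n.+1%:R) * (`|g| / (l * u)) = n.+1%:R * (dist * (`|g| / l)).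
    exact: dist_ge.
  by split; field; rewrite !gt_eqF.
(* By [far] and [unif_g], [xi] is at distance at least [dl] from [x], while this distance is at most
   b |d|. *)
have step_ge : dl <= b * (`|g| / l).
  have : dl <= `|xi - x|.
    by rewrite leNgt; apply/negP => /(unif_g _ _ Kx); rewrite ltNge far.
  move=> /le_trans; apply; rewrite /xi [x + _]addrC addrK !normrZ.
  rewrite (ger0_norm t0) (gtr0_norm b0).
  apply: (@le_trans _ _ (b * `|d|)); last by rewrite ler_pM2l.
  by rewrite ler_piMl// mulr_ge0// ltW.
(* The accepted step length is b / 2, whence the 2 in the second constant. *)
rewrite exprSr -/b.
have theta_b : 0 <= theta * (b / 2) by rewrite ltW ?mulr_gt0 ?divr_gt0.
have := ler_wpM2l theta_b gdg.
have : theta * l * dl * ep / (2 * u) <= theta * (b / 2) * (`|g| ^+ 2 / u).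
  have -> : theta * l * dl * ep / (2 * u) = (theta * l / (2 * u)) * (dl * ep).
    by field; rewrite gt_eqF.
  have -> : theta * (b / 2) * (`|g| ^+ 2 / u) =
      (theta * l / (2 * u)) * (b * (`|g| / l) * `|g|).
    by field; rewrite !gt_eqF.
  rewrite ler_pM2l ?divr_gt0 ?mulr_gt0//.
  by apply: ler_pM => //; rewrite ltW.
rewrite mulrN; lra.
Qed.

(** * Nonmonotone averages of the objective values [phi] *)

Section NonmonotoneAverage.
Context {R : realType}.
Variables phi eta Q P : nat -> R.
Hypothesis Q0 : Q 0%N = 1.
Hypothesis P0 : P 0%N = phi 0%N.
Hypothesis QS : forall k, Q k.+1 = eta k * Q k + 1.
Hypothesis PS : forall k, P k.+1 = (eta k * Q k * P k + phi k.+1) / Q k.+1.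
Hypothesis eta_itv : forall k, 0 <= eta k <= 1.
Hypothesis phi_le : forall k, phi k.+1 <= P k.

Lemma averageQ_ge1 k : 1 <= Q k.
Proof.
elim: k => [|k IHk]; first by rewrite Q0.
have /andP[eta0 _] := eta_itv k.
by rewrite QS lerDr mulr_ge0// (le_trans ler01).
Qed.

Let Q_gt0 k : 0 < Q k.
Proof. exact: lt_le_trans (averageQ_ge1 k). Qed.

(** [P k.+1] is a convex combination of [P k] and [phi k.+1] in which the latter has weight 1 /
    Q_{k+1}. *)
Lemma average_decrease k c : phi k.+1 <= P k - c -> P k.+1 <= P k - c / Q k.+1.
Proof.
move=> phic; rewrite PS ler_pdivrMr// mulrBl divfK ?gt_eqF// QS mulrDr.
lra.
Qed.

Lemma average_nonincreasing : nonincreasing_seq P.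
Proof.
apply/nonincreasing_seqP => k.
by have := @average_decrease k 0; rewrite mul0r !subr0; exact.
Qed.

Lemma average_le0 k : P k <= phi 0%N.
Proof. by rewrite -P0; exact: average_nonincreasing. Qed.

(** [P k.+1] averages [phi k.+1] with [P k], which is no smaller by [phi_le]. *)
Lemma le_average k : phi k <= P k.
Proof.
case: k => [|k]; first by rewrite P0.
have /andP[eta0 _] := eta_itv k.
rewrite PS ler_pdivlMr// QS.
have := ler_wpM2l (mulr_ge0 eta0 (ltW (Q_gt0 k))) (phi_le k).
lra.
Qed.

Lemma averageQ_leS k : Q k <= k.+1%:R.
Proof.
elim: k => [|k IHk]; first by rewrite Q0.
have /andP[eta0 eta1] := eta_itv k.
by rewrite QS -[in leRHS]natr1 lerD2r (le_trans _ IHk)// ler_piMl// ltW.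
Qed.

(** The bound is the fixed point of q |-> c q + 1, which dominates the recursion of [Q]. *)
Lemma averageQ_bounded (c : R) k :
  (forall k, eta k <= c) -> c < 1 -> Q k <= (1 - c)^-1.
Proof.
move=> etac c1; have c1' : 0 < 1 - c by rewrite subr_gt0.
have c0 : 0 <= c by have /andP[/le_trans->] := eta_itv 0%N.
elim: k => [|k IHk].
  by rewrite Q0 invf_ge1// lerBlDr lerDl.
have /andP[eta0 _] := eta_itv k.
have := ler_pM eta0 (ltW (Q_gt0 k)) (etac k) IHk.
have -> : c * (1 - c)^-1 = (1 - c)^-1 - 1.
  by field; rewrite gt_eqF.
by rewrite QS; lra.
Qed.

Hypothesis phi_ge0 : forall k, 0 <= phi k.

Let P_ge0 k : 0 <= P k.
Proof. exact: le_trans (phi_ge0 k) (le_average k). Qed.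

Lemma often_small_decrease c N :
  0 < c -> exists2 k, (N <= k)%N & P k - c < phi k.+1.
Proof.
move=> c0; apply: contrapT => no_k.
have dec k : (N <= k)%N -> phi k.+1 <= P k - c.
  by move=> Nk; rewrite leNgt; apply/negP => phik; apply: no_k; exists k.
(* The decreases telescope; [harmonic i] is 1 / (i + 1), hence at most 1 / Q_i by [averageQ_leS]. *)
have sum_le k : c * series harmonic (N + k).+1 <=
    c * series harmonic N.+1 + P N - P (N + k)%N.
  elim: k => [|k IHk]; first by rewrite addn0 addrK.
  rewrite addnS seriesS mulrDr.
  have := average_decrease _ _ (dec (N + k)%N (leq_addr _ _)).
  have : c * harmonic (N + k).+1 <= c / Q (N + k).+1.
    by rewrite ler_pM2l//= lef_pV2 ?posrE// averageQ_leS.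
  by move: IHk; set s1 := series _ _; set s2 := series _ _; lra.
apply: (@dvg_harmonic R); apply: nondecreasing_is_cvgn.
  apply/nondecreasing_seqP => k.
  by rewrite seriesS lerDr harmonic_ge0.
(* Since P >= 0, dividing [sum_le] by [c] bounds all partial sums. *)
exists (series harmonic N.+1 + P N / c) => _ [k _ <-].
have harm_le : series harmonic k <= series harmonic (N + k).+1 :> R.
  have : nondecreasing_seq (series (@harmonic R)).
    by apply/nondecreasing_seqP => i; rewrite seriesS lerDr harmonic_ge0.
  by apply; rewrite leqW// leq_addl.
apply: (le_trans harm_le).
rewrite -(ler_pM2l c0) mulrDr [c * (_ / _)]mulrC divfK ?gt_eqF//.
by have := sum_le k; have := P_ge0 (N + k)%N; lra.
Qed.

(** [P] is nonincreasing and nonnegative, so its decrements tend to 0, whereas a drop of [phi] by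
    [c] would make the decrement at least c (1 - b). *)
Lemma eventually_small_decrease (b c : R) :
  (forall k, eta k <= b) -> b < 1 -> 0 < c ->
  \forall k \near \oo, P k - c < phi k.+1.
Proof.
move=> etab b1 c0; have b1' : 0 < 1 - b by rewrite subr_gt0.
have cvgP : cvgn P.
  apply: nonincreasing_is_cvgn; first exact: average_nonincreasing.
  by exists 0 => _ [k _ <-].
have dP0 : (P k - P k.+1) @[k --> \oo] --> (0 : R).
  rewrite -(subrr (limn P)); apply: cvgB => //.
  by rewrite (cvg_shiftS P).
have cb0 : 0 < c * (1 - b) by rewrite mulr_gt0.
near=> k; have dPk : P k - P k.+1 < c * (1 - b).
  by near: k; exact: (cvgr_lt _ dP0).
rewrite ltNge; apply/negP => /average_decrease dec.
suff : c * (1 - b) <= c / Q k.+1 by lra.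
by rewrite ler_pM2l// -[1 - b]invrK lef_pV2 ?posrE ?invr_gt0// averageQ_bounded.
Unshelve. all: by end_near. Qed.

End NonmonotoneAverage.

(** * Lower limits and convergence of the gradients *)

(** Every tail has infimum 0, so the sequence of tail infima is constant. *)
Lemma limn_einf_eq0 (R : realType) (v : nat -> R) :
  (forall k, 0 <= v k) ->
  (forall e N, 0 < e -> exists2 k, (N <= k)%N & v k < e) ->
  limn_einf (fun k => (v k)%:E) = 0%:E.
Proof.
move=> v0 small; rewrite limn_einf_lim.
suff -> : einfs (fun k => (v k)%:E) = cst 0%:E by exact: lim_cst.
apply/funext => N; rewrite /einfs/=.
apply/eqP; rewrite eq_le; apply/andP; split.
  apply/lee_addgt0Pr => e e0; have [k Nk vk] := small e N e0.
  rewrite add0e; apply: (@le_trans _ _ (v k)%:E); last by rewrite lee_fin ltW.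
  by apply: ereal_inf_lbound; exists k.
by apply: le_ereal_inf_tmp => _ [k _ <-]; rewrite lee_fin.
Qed.

Theorem theorem3p4 (R : realType) (m n : nat)
  (F : 'cV[R]_n -> 'cV[R]_m)
  (F_C2 : forall i : 'I_m, class_C2 (fun z => F z i 0))
  (x0 : 'cV[R]_n)
  (gamma theta etamin etamax l u rho : R)
  (gamma_bounds : 0 < gamma < 1)
  (theta_bounds : 0 < theta < 1)
  (etamin_ge0 : 0 <= etamin)
  (etamin_le_etamax : etamin <= etamax)
  (etamax_le1 : etamax <= 1)
  (l_bounds : 0 < l <= 1)
  (u_ge1 : 1 <= u)
  (rho_gt0 : 0 < rho)
  (A1 : exists omega : R, 0 < omega /\
    forall z, level_set (lsq F) x0 z -> enorm z <= omega)
  (A2 : exists L1 L2 : R, forall y z,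
    level_set (lsq F) x0 y -> level_set (lsq F) x0 z ->
    opnorm (jac F y - jac F z) <= L1 * enorm (y - z) /\
    enorm (F y - F z) <= L2 * enorm (y - z))
  (x d : nat -> 'cV[R]_n) (alpha : nat -> R) (s : nat -> 'cV[R]_n)
  (H : nat -> 'M[R]_n) (eta Q P : nat -> R)
  (run : ASDH_run F x0 gamma theta etamin etamax l u rho
           x d alpha s H eta Q P) :
  [/\ forall k, level_set (lsq F) x0 (x k),
      limn_einf (fun k => (enorm (gradient (lsq F) (x k)))%:E) = 0%:E &
      etamax < 1 ->
      enorm (gradient (lsq F) (x k)) @[k --> \oo] --> (0 : R)].
Proof.
have [l0 l1] := andP l_bounds; have u0 := lt_le_trans ltr01 u_ge1.
set f := lsq F; set g := gradient f.
have [x00 H0 Q0 P00 dE step sE xE HS etaP QS PS] := run.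
have dir k : `|d k| <= `|g (x k)| / l /\
    ((g (x k))^T *m d k) 0 0 <= - (`|g (x k)| ^+ 2 / u).
  have [r Hr rlu] : exists2 r, H k = diag_mx r & forall i, l <= r 0 i <= u.
    case: k => [|k].
      exists (const_mx 1); first by rewrite H0 diag_const_mx.
      by move=> i; rewrite mxE l1.
    rewrite HS; eexists; first by [].
    by move=> i; rewrite mxE hess_entry_itv.
  by rewrite dE Hr; exact: diag_direction.
have xS k : exists j : nat,
  [/\ x k.+1 = x k + 2^-1 ^+ j *: d k,
      sufficient_decrease F theta (x k) (d k) (P k) (2^-1 ^+ j) &
      forall i, (i < j)%N ->
        ~~ sufficient_decrease F theta (x k) (d k) (P k) (2^-1 ^+ i)].
  have [j [aj acc rej]] := step k.
  by exists j; split=> //; rewrite xE sE aj.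
have fS_le k : f (x k.+1) <= P k.
  have [j [-> acc _]] := xS k; apply: (le_trans acc).
  have [th0 _] := andP theta_bounds; have [_ gd] := dir k.
  rewrite gerDl pmulr_rle0 ?mulr_gt0 ?exprn_gt0 ?invr_gt0//.
  by rewrite (le_trans gd)// oppr_le0 divr_ge0 ?sqr_ge0 ?ltW.
have eta_le k : eta k <= etamax by have /andP[] := etaP k.
have eta01 k : 0 <= eta k <= 1.
  rewrite (le_trans (eta_le k))// andbT (le_trans etamin_ge0)//.
  by have /andP[] := etaP k.
have P0 : P 0%N = f (x 0%N) by rewrite x00; exact: P00.
pose phi k := f (x k).
have f_le_P := le_average phi eta Q P Q0 P0 QS PS eta01 fS_le.
(* The chain is f(x_k) <= P_k <= P_0 = f(x_0). *)
have x_level k : level_set f x0 (x k).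
  rewrite /level_set/= -x00 (le_trans (f_le_P k))//.
  exact: (average_le0 phi eta Q P Q0 P0 QS PS eta01 fS_le).
have compact_level : compact (level_set f x0).
  apply: cV_bounded_closed_compact.
    have [w [w0 bd]] := A1; exists w; split; first exact: gtr0_real.
    move=> N wN z /bd zw.
    exact: le_trans (normr_le_enorm _) (le_trans zw (ltW wN)).
  have -> : level_set f x0 = f @^-1` [set y | y <= f x0] by [].
  apply: closed_comp; last exact: closed_le.
  by move=> z _; apply: continuous_lsq.
(* The constant [c] depends on [e] but not on [k]; both limits below use the contrapositive, that a
   decrease smaller than [c] forces the gradient norm below [e]. *)
have decrease e : 0 < e -> exists2 c, 0 < c &
    forall k, e <= enorm (g (x k)) -> phi k.+1 <= P k - c.
  move=> e0.
  have [c c0 dec] := backtracking_decrease _ _ f (level_set f x0) theta l u e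
    (differentiable_lsq _ F_C2) (continuous_gradient_lsq _ F_C2)
    compact_level theta_bounds l0 u0 e0.
  exists c => // k ek; have [j [xj acc rej]] := xS k; have [dk gdk] := dir k.
  by rewrite /phi xj; exact: (dec _ _ _ j (x_level k) (f_le_P k)).
split=> // [|etamax_lt1].
  apply: limn_einf_eq0 => [k|e N e0]; first exact: enorm_ge0.
  have [c c0 dec] := decrease e e0.
  have [k Nk phik] := often_small_decrease phi eta Q P Q0 P0 QS PS eta01 fS_le
    (fun k => lsq_ge0 F (x k)) c N c0.
  exists k => //; rewrite ltNge; apply/negP => /dec.
  by rewrite leNgt phik.
apply/cvgrPdist_lt => e e0; have [c c0 dec] := decrease e e0.
have := eventually_small_decrease phi eta Q P Q0 P0 QS PS eta01 fS_le
  (fun k => lsq_ge0 F (x k)) etamax c eta_le etamax_lt1 c0.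
apply: filterS => k phik; rewrite sub0r normrN ger0_norm ?enorm_ge0//.
by rewrite ltNge; apply/negP => /dec; rewrite leNgt phik.
Qed.
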